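(* Let $(X,f_{1,\infty})$ be a non-autonomous discrete dynamical system where each $f_n$ is surjective. Consider the discrete topology on the set $\mathcal{F}=\{f_1^n:n\in\mathbb{N}\}$. Then the NDDS $(X,f_{1,\infty})$ is locally eventually onto if and only if the generic dynamical system $(X,\mathcal{F})$ is locally eventually onto.
   Context: $\mathbb{N}=\{1,2,3,\dots\}$. A non-autonomous discrete dynamical system (NDDS) is a pair $(X,f_{1,\infty})$ where $X$ is a compact metric space and $f_{1,\infty}=(f_n)_{n\in\mathbb{N}}$ is a sequence of continuous maps $f_n:X\to X$; $f_1^n:=f_n\circ\cdots\circ f_1$. The NDDS is locally eventually onto if for every nonempty open $V\subset X$ there is $k\in\mathbb{N}$ with $f_1^k(V)=X$. A generic dynamical system (GDS) is a pair $(X,\mathcal{F})$ where $X$ is a compact metric space and $\mathcal{F}$ is a collection of continuous maps $X\to X$. When $\mathcal{F}$ is a topological space, the GDS is locally eventually onto if for every nonempty open $U\subset X$ there exists a compact subset $S\subset\mathcal{F}$ such that $f(U)=X$ for all $f\in\mathcal{F}\setminus S$.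
   Formalization: The ''if'' direction fails when the set F is finite (X two points, all f_n = id); the equivalence is proved for the iterates indexed by n with N discrete, and for the set F when F is infinite; ''only if'' is proved for every F. *)

(* Defs.v *)
From HB Require Import structures.
From mathcomp Require Import all_boot all_order all_algebra.
From mathcomp Require Import all_classical all_reals topology metric_structure.

Set Implicit Arguments.
Unset Strict Implicit.
Unset Printing Implicit Defensive.

Local Open Scope classical_set_scope.

(* The maps are stored from index 0: [ndds_map n] is f_(n+1). *)
Record ndds (R : realType) (X : metricType R) := Ndds {
  ndds_map :> nat -> X -> X ;
  ndds_compact : compact [set: X] ;
  ndds_continuous : forall n, continuous (ndds_map n) }.

(* [ndds_iter f n] is f_1^n = f_n \o ... \o f_1, with the convention f_1^0 = id. *)
Fixpoint ndds_iter (R : realType) (X : metricType R) (f : ndds X) (n : nat) :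
    X -> X :=
  if n is m.+1 then f m \o ndds_iter f m else id.

Definition ndds_leo (R : realType) (X : metricType R) (f : ndds X) : Prop :=
  forall V : set X, open V -> V !=set0 ->
    exists2 k : nat, (0 < k)%N & ndds_iter f k @` V = [set: X].

(* A topologized collection of maps is a topological space together with a map
   into the continuous self-maps of X. It is a genuine set of maps when
   [gds_map] is injective, and an indexed family, possibly with repetitions,
   in general. *)
Record gds (R : realType) (X : metricType R) := Gds {
  gds_index : topologicalType ;
  gds_map :> gds_index -> X -> X ;
  gds_compact : compact [set: X] ;
  gds_continuous : forall i, continuous (gds_map i) }.

Definition gds_leo (R : realType) (X : metricType R) (F : gds X) : Prop :=
  forall U : set X, open U -> U !=set0 ->
    exists2 S : set (gds_index F), compact S &
      forall i, ~ S i -> F i @` U = [set: X].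

Lemma ndds_iter_continuous (R : realType) (X : metricType R) (f : ndds X) n :
  continuous (ndds_iter f n).
Proof.
elim: n => [|n IHn] x; first exact: cvg_id.
by apply: continuous_comp; [exact: IHn|exact: ndds_continuous].
Qed.

(* (X, (f_1^n)_(n >= 1)): the family indexed by the discrete space of positive
   integers, in which f_1^m and f_1^n with m <> n are different members. *)
Definition gds_of_iter_family (R : realType) (X : metricType R) (f : ndds X) :
    gds X :=
  @Gds R X (discrete_topology {n : nat | (0 < n)%N})
    (fun n => ndds_iter f (sval n)) (ndds_compact f)
    (fun n => @ndds_iter_continuous R X f (sval n)).

Definition ndds_iterates (R : realType) (X : metricType R) (f : ndds X) :
    set (X -> X) :=
  [set ndds_iter f n | n in [set n | (0 < n)%N]].

Lemma ndds_iterates_continuous (R : realType) (X : metricType R) (f : ndds X)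
  (g : set_type (ndds_iterates f)) : continuous (val g).
Proof. by case: (set_valP g) => n _ <-; exact: ndds_iter_continuous. Qed.

(* (X, {f_1^n : n >= 1}): the set of maps, with the discrete topology; equal
   iterates are identified. When this set is finite it is itself compact, so
   [gds_leo] holds vacuously, even if [ndds_leo] fails (e.g. f_n = id on two
   points); this is why the indexed family above is also considered. *)
Definition gds_of_iter_set (R : realType) (X : metricType R) (f : ndds X) :
    gds X :=
  @Gds R X (discrete_topology (set_type (ndds_iterates f)))
    (fun g => val (g : set_type (ndds_iterates f))) (ndds_compact f)
    (@ndds_iterates_continuous R X f).

(* Main.v *)
Require Import Defs.
From mathcomp Require Import all_boot all_order all_algebra.
From mathcomp Require Import all_classical all_reals topology metric_structure.

(** Since the maps are surjective, [f_1^k(V) = X] propagates to every [n >= k],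
    so only finitely many iterates fail to map [V] onto [X]. Conversely,
    compact subsets of a discrete space are finite, so an infinite index space
    always contains an iterate outside the exceptional compact set. *)

Local Open Scope classical_set_scope.

Lemma compact_discrete_finite (T : discreteTopologicalType) (A : set T) :
  compact A -> finite_set A.
Proof.
(* Otherwise the sets with finite complement in [A] form a proper filter without
   cluster points. *)
move=> A_compact; apply: contrapT => A_inf.
pose F : set_system T := [set B | finite_set (A `\` B)].
have F_filter : ProperFilter F.
  apply: Build_ProperFilter_ex.
    move=> B FB; apply: contrapT => /set0P/negP; rewrite negbK => /eqP B0.
    by apply: A_inf; move: FB; rewrite /F /= B0 setD0.
  split; first by rewrite /F /= setDT; exact: finite_set0.
    by move=> B C FB FC; rewrite /F /= setDIr finite_setU.
  by move=> B C BC; apply: sub_finite_set; exact: setDS.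
(* At a cluster point [p], the neighbourhood [[set p]] would have to meet [A] minus [p], a member of
   [F] because it omits at most one point of [A]. *)
have [|p [_ /(_ (A `\` [set p]) [set p])]] := A_compact F F_filter.
  by rewrite /F /= setDv; exact: finite_set0.
case=> [||x [[_ xp] /xp]] //; last exact: discrete_set1.
rewrite /F /= setDD; exact: sub_finite_set (finite_set1 p).
Qed.

Lemma compact_discrete_setC_neq0 (T : discreteTopologicalType) (A : set T) :
  infinite_set [set: T] -> compact A -> (~` A) !=set0.
Proof.
move=> T_inf /compact_discrete_finite A_fin.
by apply: infinite_setN0; apply: cofinite_set_infinite => //; rewrite setCK.
Qed.

Section Iterates.
Context (R : realType) (X : metricType R) (f : ndds X).

Lemma ndds_iter_image_setT (V : set X) (k n : nat) :
  (forall m : nat, range (f m) = [set: X]) ->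
  k <= n -> ndds_iter f k @` V = [set: X] -> ndds_iter f n @` V = [set: X].
Proof.
move=> f_surj + Vk; elim: n => [|n IHn]; first by rewrite leqn0 => /eqP <-.
rewrite leq_eqVlt => /predU1P[<- //|/IHn Vn].
by rewrite /= -image_comp Vn.
Qed.

(** Indices are counted, not maps, so coinciding iterates do no harm; the predecessor carries the
    positive integers onto all of [nat]. *)
Lemma infinite_iter_family :
  infinite_set [set: gds_index (gds_of_iter_family f)].
Proof.
move=> /(finite_image (fun n : {n | 0 < n} => (sval n).-1)).
suff -> : range (fun n : {n | 0 < n} => (sval n).-1) = [set: nat].
  exact: infinite_nat.
by apply/seteqP; split => // n _; exists (exist _ n.+1 isT).
Qed.

Lemma infinite_iter_set :
  infinite_set (ndds_iterates f) ->
  infinite_set [set: gds_index (gds_of_iter_set f)].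
Proof.
apply: contra_not => /(finite_image (fun g : ndds_iterates f => val g)).
by apply: sub_finite_set => g fg; exists (SigSub (mem_set fg)).
Qed.

Lemma gds_leo_iter_family :
  (forall m : nat, range (f m) = [set: X]) ->
  ndds_leo f -> gds_leo (gds_of_iter_family f).
Proof.
move=> f_surj f_leo U Uo U0; have [k _ Uk] := f_leo U Uo U0.
exists (sval @^-1` `I_k).
  apply/finite_compact/finite_preimage/finite_II.
  by move=> m n _ _; apply: val_inj.
move=> [n n_gt0] /= /negP; rewrite -leqNgt => kn.
exact: ndds_iter_image_setT kn Uk.
Qed.

Lemma gds_leo_iter_set :
  (forall m : nat, range (f m) = [set: X]) ->
  ndds_leo f -> gds_leo (gds_of_iter_set f).
Proof.
move=> f_surj f_leo U Uo U0; have [k _ Uk] := f_leo U Uo U0.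
(* One map can be an iterate for several indices. Removing every map that has some index below [k]
   ensures that whichever index represents a remaining map is at least [k]. Index 0 may put the
   identity into this set, which stays finite. *)
exists ((fun g : ndds_iterates f => val g) @^-1` (ndds_iter f @` `I_k)).
  apply/finite_compact/finite_preimage/finite_image/finite_II.
  by move=> g h _ _; apply: val_inj.
move=> g /=; have [n _ <-] := set_valP g => gS.
apply: ndds_iter_image_setT Uk => //.
by rewrite leqNgt; apply/negP => nk; apply: gS; exists n.
Qed.

Lemma ndds_leo_iter_family : gds_leo (gds_of_iter_family f) -> ndds_leo f.
Proof.
move=> F_leo U Uo U0; have [S S_compact SU] := F_leo U Uo U0.
have [[n n_gt0] /SU Un] := compact_discrete_setC_neq0
  (discrete_topology {n | 0 < n}) S infinite_iter_family S_compact.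
by exists n.
Qed.

Lemma ndds_leo_iter_set :
  infinite_set (ndds_iterates f) ->
  gds_leo (gds_of_iter_set f) -> ndds_leo f.
Proof.
move=> f_inf F_leo U Uo U0; have [S S_compact SU] := F_leo U Uo U0.
have [g /SU /=] := compact_discrete_setC_neq0
  (discrete_topology (ndds_iterates f)) S (infinite_iter_set f_inf) S_compact.
(* Any positive index representing the map [g] outside [S] serves as the required time. *)
by have [n n_gt0 <-] := set_valP g; exists n.
Qed.

End Iterates.

Theorem theorem4p10 (R : realType) (X : metricType R) (f : ndds X)
  (f_surj : forall n : nat, range (f n) = [set: X]) :
  [/\ ndds_leo f <-> gds_leo (gds_of_iter_family f),
      ndds_leo f -> gds_leo (gds_of_iter_set f) &
      infinite_set (ndds_iterates f) ->
        (ndds_leo f <-> gds_leo (gds_of_iter_set f))].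
Proof.
split.
- by split; [exact: gds_leo_iter_family|exact: ndds_leo_iter_family].
- exact: gds_leo_iter_set.
- by split; [exact: gds_leo_iter_set|exact: ndds_leo_iter_set].
Qed.
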